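(* Suppose $\boldsymbol{\lambda}^n/n\to\boldsymbol{\lambda}\ge 0$ as $n\to\infty$ and the covariance matrix $C$ is positive definite. Then the SLOPE estimator $\hat{\boldsymbol\beta}_n$ satisfies $\hat{\boldsymbol\beta}_n\to \operatorname{argmin}_{\beta\in\mathbb{R}^p} Z(\beta)$ in probability, where $$Z(\beta)=\tfrac12(\beta-\beta^0)^{T}C(\beta-\beta^0)+J_{\boldsymbol{\lambda}}(\beta).$$ In particular, in the case $\boldsymbol{\lambda}=0$, $\hat{\boldsymbol\beta}_n\to\beta^0$ in probability.
   Context: Linear model: $p$ is fixed, $\beta^0\in\mathbb{R}^p$ is fixed, $X_1,X_2,\dots$ are i.i.d. centered random vectors in $\mathbb{R}^p$ with covariance matrix $C$, and $\varepsilon_1,\varepsilon_2,\dots$ are i.i.d. centered real random variables with (finite) variance $\sigma^2$, independent of the $X_i$. For each $n$ put $X=(X_1,\dots,X_n)^T\in\mathbb{R}^{n\times p}$, $\varepsilon=(\varepsilon_1,\dots,\varepsilon_n)^T$ and $y=X\beta^0+\varepsilon$. SLOPE norm: for $\boldsymbol{\lambda}=(\lambda_1,\dots,\lambda_p)$ with $\lambda_1\ge\dots\ge\lambda_p\ge0$, $J_{\boldsymbol{\lambda}}(\beta)=\sum_{i=1}^p\lambda_i|\beta|_{(i)}$, where $|\beta|_{(1)}\ge\dots\ge|\beta|_{(p)}$ are the absolute values of the coordinates of $\beta$ in decreasing order. For each $n$, $\boldsymbol{\lambda}^n$ is a deterministic vector with $\lambda^n_1\ge\dots\ge\lambda^n_p\ge0$,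 and the SLOPE estimator is $$\hat{\boldsymbol\beta}_n=\operatorname{argmin}_{\beta\in\mathbb{R}^p}\ \tfrac12\|y-X\beta\|_2^2+J_{\boldsymbol{\lambda}^n}(\beta).$$ *)

(* Defs.v *)
From HB Require Import structures.
From mathcomp Require Import all_boot all_order all_algebra.
From mathcomp Require Import all_classical all_reals all_analysis.
Set Implicit Arguments.
Unset Strict Implicit.
Unset Printing Implicit Defensive.
Import Order.TTheory GRing.Theory Num.Theory.
Import numFieldNormedType.Exports.

Local Open Scope classical_set_scope.
Local Open Scope ring_scope.

Section Slope.
Context {R : realType}.

Definition l2norm {n : nat} (v : 'cV[R]_n) : R :=
  Num.sqrt (\sum_i v i 0 ^+ 2).

Definition posdef {p : nat} (C : 'M[R]_p) : Prop :=
  C^T = C /\ forall v : 'cV[R]_p, v != 0 -> 0 < (v^T *m C *m v) 0 0.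

Definition argmin {V : Type} (f : V -> R) : set V :=
  [set b | forall b', f b <= f b'].

Definition slope_weights {p : nat} (l : 'cV[R]_p) : Prop :=
  (forall i, 0 <= l i 0) /\ (forall i j : 'I_p, (i <= j)%N -> l j 0 <= l i 0).

Definition sorted_abs {p : nat} (b : 'cV[R]_p) : seq R :=
  sort (fun x y : R => y <= x) [seq `|b i 0| | i <- enum 'I_p].

Definition slope_norm {p : nat} (l b : 'cV[R]_p) : R :=
  \sum_i l i 0 * (sorted_abs b)`_i.

Definition slope_objective {n p : nat} (X : 'M[R]_(n, p)) (y : 'cV[R]_n)
    (l b : 'cV[R]_p) : R :=
  2^-1 * l2norm (y - X *m b) ^+ 2 + slope_norm l b.

Definition slope_limit {p : nat} (C : 'M[R]_p) (b0 l b : 'cV[R]_p) : R :=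
  2^-1 * ((b - b0)^T *m C *m (b - b0)) 0 0 + slope_norm l b.

(* Random vectors take values in [p.-tuple R], which carries the product
   (Borel) sigma-algebra in the library. *)
Definition vec {p : nat} (u : p.-tuple R) : 'cV[R]_p := \col_i tnth u i.

End Slope.

Section Probability.
Context {d : measure_display} {T : measurableType d} {R : realType}
  (P : probability T R).

Definition mutually_independent {d'} {T' : measurableType d'}
    (X : nat -> {RV P >-> T'}) : Prop :=
  forall (s : seq nat) (A : nat -> set T'), uniq s ->
    (forall i, measurable (A i)) ->
    P (\big[setI/setT]_(i <- s) (X i @^-1` A i)) =
    (\prod_(i <- s) P (X i @^-1` A i))%E.

Definition iid {d'} {T' : measurableType d'}
    (X : nat -> {RV P >-> T'}) : Prop :=
  mutually_independent X /\
  forall i A, measurable A ->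
    distribution P (X i) A = distribution P (X 0%N) A.

Definition sigma_of {d'} {T' : measurableType d'}
    (X : nat -> {RV P >-> T'}) : set (set T) :=
  <<s \bigcup_i preimage_set_system setT (X i) measurable >>.

Definition independent_sequences {d1 d2}
    {T1 : measurableType d1} {T2 : measurableType d2}
    (X : nat -> {RV P >-> T1}) (Y : nat -> {RV P >-> T2}) : Prop :=
  forall A B, sigma_of X A -> sigma_of Y B -> P (A `&` B) = (P A * P B)%E.

Definition coordinate {p : nat} (X : {RV P >-> p.-tuple R}) (j : 'I_p)
  : T -> R := fun t => tnth (X t) j.

(* The integrability conditions matter: expectations and covariances are total
   and take arbitrary values on non-integrable functions. *)
Definition centered_with_covariance {p : nat} (X : {RV P >-> p.-tuple R})
    (C : 'M[R]_p) : Prop :=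
  [/\ forall j, coordinate X j \in Lfun P 2%:E,
      forall j, ('E_P[coordinate X j] = 0)%E &
      forall j k, covariance P (coordinate X j) (coordinate X k) = (C j k)%:E].

Definition centered_with_variance (e : {RV P >-> R}) (v : R) : Prop :=
  [/\ (e : T -> R) \in Lfun P 2%:E, ('E_P[e] = 0)%E & ('V_P[e] = v%:E)%E].

Definition design {p : nat} (X : nat -> {RV P >-> p.-tuple R})
    (n : nat) (t : T) : 'M[R]_(n, p) := \matrix_(i, j) tnth (X i t) j.

Definition noise (e : nat -> {RV P >-> R}) (n : nat) (t : T) : 'cV[R]_n :=
  \col_i e i t.

Definition response {p : nat} (X : nat -> {RV P >-> p.-tuple R})
    (e : nat -> {RV P >-> R}) (b0 : 'cV[R]_p) (n : nat) (t : T) : 'cV[R]_n :=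
  design X n t *m b0 + noise e n t.

(* The minimiser need not be unique for a given sample (e.g. when n < p), so an
   estimator is any random vector selecting a minimiser. *)
Definition slope_estimator {p : nat} (X : nat -> {RV P >-> p.-tuple R})
    (e : nat -> {RV P >-> R}) (b0 l : 'cV[R]_p) (n : nat)
    (bhat : {RV P >-> p.-tuple R}) : Prop :=
  forall t, argmin (slope_objective (design X n t) (response X e b0 n t) l)
                   (vec (bhat t)).

Definition cvg_in_probability {p : nat} (Y : nat -> {RV P >-> p.-tuple R})
    (b : 'cV[R]_p) : Prop :=
  forall eps : R, 0 < eps ->
    (fun n => P [set t | eps < l2norm (vec (Y n t) - b)]) @ \oo --> 0%E.

End Probability.

(* Main.v *)
From HB Require Import structures.
Require Import Defs.
From mathcomp Require Import all_boot all_order all_algebra.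
From mathcomp Require Import all_classical all_reals all_analysis.
From mathcomp Require Import fingroup perm measurable_realfun ring lra.
Import Order.TTheory GRing.Theory Num.Theory.
Import numFieldNormedType.Exports.
Local Open Scope classical_set_scope.
Local Open Scope ring_scope.

(** Write h = b - beta0, G = n^-1 X^T X and W = n^-1 X^T eps. Since
    y - X b = eps - X h, the SLOPE objective divided by n is, up to a constant,
    1/2 h^T G h - h^T W + J_(lam n / n) b ([slope_objective_scaled]), and Z is
    the same function with G, W and lam n / n replaced by C, 0 and lambda. The
    theorem says that minimisers are stable under this perturbation.

    Limit problem. By the rearrangement inequality the SLOPE norm is the largest
    of the sums over i of l_i |b_(s i)|, where s is a permutation; hence it is
    convex, while the quadratic part of Z is strongly convex because C
    is positive definite. Strong convexity gives the existence and uniqueness of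
    the minimiser a of Z, and the quadratic growth of Z around it.

    Stability. If the absolute values of the entries of G - C, of W and of
    lam n / n - lambda each sum to at most delta, then exchanging the empirical objective for Z costs at most
    O(delta) (1 + |b - a|)^2 at a and at its own minimiser b. Comparing with
    quadratic growth makes |b - a| small ([slope_stability]): both sides are
    quadratic in |b - a|, so a small delta wins even for a distant b.

    Law of large numbers. The entries of G - C are centred averages of i.i.d.
    variables X_ij X_ik, of which only a first moment is known; this is
    Khinchin's weak law ([weak_law]). The entries of W are averages of the pairwise
    orthogonal variables X_ij eps_i, whose second moments are bounded
    ([score_law]). Both are shown to vanish in mean, a mode of convergence for
    which the total sampling error is just a finite sum; one application of
    Markov's inequality then gives convergence in probability. *)

Section Deterministic.
Context {R : realType}.

Lemma cvg_sumr {I : Type} (r : seq I) (u : I -> nat -> R) (a : I -> R) :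
  (forall i, u i @ \oo --> a i) ->
  (fun n => \sum_(i <- r) u i n) @ \oo --> \sum_(i <- r) a i.
Proof.
move=> ua; elim: r => [|i r IH].
  by under eq_fun do rewrite big_nil; rewrite big_nil; exact: cvg_cst.
by under eq_fun do rewrite big_cons; rewrite big_cons; exact: cvgD.
Qed.

(** * Sorting and rearrangement *)

(** By induction on the sorted sequence s: exchanging the head of x with an
    occurrence of the maximum a changes the sum by (l_0 - l_k) (a - b) >= 0,
    and the two tails are compared by the induction hypothesis. *)
Lemma rearrangement (s x : seq R) (l : nat -> R) :
  sorted (fun a b : R => b <= a) s -> perm_eq x s ->
  (forall i j, (i <= j < size s)%N -> l j <= l i) ->
  \sum_(i < size s) l i * x`_i <= \sum_(i < size s) l i * s`_i.
Proof.
elim: s x l => [|a s IH] x l; first by rewrite !big_ord0.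
have ge_trans : transitive (fun a b : R => b <= a).
  by move=> u v w uv /le_trans; apply.
move=> /[dup] sas /path_sorted ss xs l_mono.
have l_mono' i j : (i <= j < size s)%N -> l j.+1 <= l i.+1.
  by move=> ij; apply: l_mono.
have a_max b : b \in a :: s -> b <= a.
  rewrite inE => /predU1P[->//|bs].
  by move/(order_path_min ge_trans)/allP: sas; apply.
case: x xs => [|b y] xs; first by move/perm_size: xs.
have ba : b <= a by apply: a_max; rewrite -(perm_mem xs) mem_head.
rewrite !big_ord_recl /=.
have : a \in b :: y by rewrite (perm_mem xs) mem_head.
rewrite inE => /predU1P[ab|ay].
  rewrite ab lerD2l; apply: (IH y (fun i => l i.+1)) => //.
  by move: xs; rewrite ab perm_cons.
case/splitPr: ay xs => y1 y2 xs.
(* Put the displaced head b where the maximum a stood. *)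
have xs' : perm_eq (y1 ++ b :: y2) s.
  rewrite -(perm_cons a) -(permPr xs); apply/seq.permP => Q.
  rewrite /= !count_cat /= addnCA [RHS]addnCA; congr addn; exact: addnCA.
have ks : (size y1 < size s)%N.
  by rewrite -(perm_size xs') size_cat /= addnS ltnS leq_addr.
pose k := Ordinal ks.
apply: le_trans (_ : _ <=
  l 0%N * a + \sum_(i < size s) l i.+1 * (y1 ++ b :: y2)`_i) _.
  rewrite (bigD1 k)//= [in leRHS](bigD1 k)//= !nth_cat ltnn subnn /=.
  set S1 := \sum_(_ < _ | _) _; set S2 := \sum_(_ < _ | _) _.
  have -> : S1 = S2.
    apply: eq_bigr => i ik; congr (_ * _); rewrite !nth_cat.
    case: ltnP => // yi; case E : (i - size y1)%N => [|m] //.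
    case/eqP: ik; apply/val_inj/eqP.
    by rewrite /= eqn_leq yi andbT -subn_eq0 E.
  have lk : l (size y1).+1 <= l 0%N by apply: l_mono; rewrite /= ltnS.
  rewrite !addrA lerD2r -subr_ge0.
  have -> : l 0%N * a + l (size y1).+1 * b - (l 0%N * b + l (size y1).+1 * a) =
     (l 0%N - l (size y1).+1) * (a - b) by ring.
  by rewrite mulr_ge0// subr_ge0.
by rewrite lerD2l; exact: (IH _ (fun i => l i.+1)).
Qed.

(** * The SLOPE norm *)

Section SlopeNorm.
Context {p : nat}.
Implicit Types (l a b : 'cV[R]_p).

Lemma slope_norm_ge_perm l b (s : 'S_p) : slope_weights l ->
  \sum_i l i 0 * `|b (s i) 0| <= slope_norm l b.
Proof.
move=> [l0 lm].
pose x := [seq `|b (s i) 0| | i <- enum 'I_p].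
have sz : size (sorted_abs b) = p by rewrite size_sort size_map size_enum_ord.
(* The weights as a function on nat; the default 0 lies outside the range. *)
pose l' i := if insub i is Some j then l j 0 else 0.
have l'E (i : 'I_p) : l' i = l i 0 by rewrite /l' valK.
have := @rearrangement (sorted_abs b) x l'.
rewrite sz => H.
apply: le_trans (_ : \sum_(i < p) l' i * x`_i <= _).
  apply: ler_sum => i _; rewrite l'E (nth_map i) ?size_enum_ord//.
  by rewrite nth_ord_enum.
apply: le_trans (H _ _ _) _.
- by apply: sort_sorted => u v; exact: le_total.
- rewrite perm_sym perm_sort.
  have -> : x = [seq `|b i 0| | i <- map s (enum 'I_p)].
    by rewrite -map_comp.
  apply: perm_map.
  have us : uniq (map s (enum 'I_p)).
    by rewrite (map_inj_uniq perm_inj) enum_uniq.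
  rewrite perm_sym; apply: (uniq_perm us (enum_uniq _)) => i.
  rewrite mem_enum inE; apply/mapP; exists ((s^-1)%g i).
    by rewrite mem_enum.
  by rewrite permKV.
- move=> i j /andP[ij jp].
  have ip := leq_ltn_trans ij jp.
  by rewrite (l'E (Ordinal ip)) (l'E (Ordinal jp)) lm.
by apply: ler_sum => i _; rewrite l'E.
Qed.

(** With [slope_norm_ge_perm], the SLOPE norm is a maximum of weighted l1 norms.
    The permutation does not depend on the weights, so the norm is also linear
    in them, whatever their signs. *)
Lemma slope_norm_perm b :
  exists s : 'S_p, forall l, slope_norm l b = \sum_i l i 0 * `|b (s i) 0|.
Proof.
pose t := [tuple `|b i 0| | i < p].
have : perm_eq (sorted_abs b) t.
  by rewrite /sorted_abs perm_sort.
move=> /tuple_permP[s E]; exists s => l; apply: eq_bigr => i _.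
rewrite E (nth_map i) ?size_enum_ord// nth_ord_enum tnth_mktuple //.
Qed.

Definition norm1 b : R := \sum_i `|b i 0|.

Lemma norm1_ge0 b : 0 <= norm1 b.
Proof. by rewrite sumr_ge0. Qed.

Lemma norm1D_le a b : norm1 (a + b) <= norm1 a + norm1 b.
Proof.
by rewrite -big_split/=; apply: ler_sum => i _; rewrite mxE ler_normD.
Qed.

Lemma norm1N b : norm1 (- b) = norm1 b.
Proof. by apply: eq_bigr => i _; rewrite mxE normrN. Qed.

Lemma coord_le_norm1 b i : `|b i 0| <= norm1 b.
Proof. by rewrite /norm1 (bigD1 i)//= lerDl sumr_ge0. Qed.

Lemma sqr_l2norm b : l2norm b ^+ 2 = \sum_i b i 0 ^+ 2.
Proof. by rewrite sqr_sqrtr// sumr_ge0// => i _; exact: sqr_ge0. Qed.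

Lemma norm1_le_l2norm b : norm1 b <= p%:R * l2norm b.
Proof.
have -> : p%:R * l2norm b = \sum_(i < p) l2norm b.
  by rewrite sumr_const card_ord mulr_natl.
apply: ler_sum => i _.
rewrite -(@ler_pXn2r _ 2)// ?nnegrE ?sqrtr_ge0// real_normK ?num_real//.
rewrite sqr_l2norm (bigD1 i)//= lerDl sumr_ge0// => k _; exact: sqr_ge0.
Qed.

Lemma slope_norm_ge0 l b : slope_weights l -> 0 <= slope_norm l b.
Proof.
move=> [l0 _]; have [s ->] := slope_norm_perm b.
by apply: sumr_ge0 => i _; rewrite mulr_ge0.
Qed.

Lemma slope_normD_le l a b : slope_weights l ->
  slope_norm l (a + b) <= slope_norm l a + slope_norm l b.
Proof.
move=> lw; have [s ->] := slope_norm_perm (a + b).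
apply: le_trans (_ : _ <= \sum_i l i 0 * `|a (s i) 0| +
                          \sum_i l i 0 * `|b (s i) 0|) _; last first.
  by rewrite lerD// slope_norm_ge_perm.
rewrite -big_split/=; apply: ler_sum => i _.
by rewrite -mulrDr ler_wpM2l ?lw.1// mxE ler_normD.
Qed.

Lemma slope_normZ_le l c b : slope_weights l ->
  slope_norm l (c *: b) <= `|c| * slope_norm l b.
Proof.
move=> lw; have [s ->] := slope_norm_perm (c *: b).
apply: le_trans (ler_wpM2l (normr_ge0 c) (slope_norm_ge_perm l b s lw)).
by rewrite mulr_sumr; apply: ler_sum => i _; rewrite mxE normrM mulrCA.
Qed.

(** For differences of weight vectors, which are neither monotone nor
    nonnegative. *)
Lemma slope_norm_bound l b : `|slope_norm l b| <= norm1 l * norm1 b.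
Proof.
have [s ->] := slope_norm_perm b.
apply: le_trans (ler_norm_sum _ _ _) _.
rewrite /norm1 mulr_suml; apply: ler_sum => i _.
by rewrite normrM normr_id ler_wpM2l// coord_le_norm1.
Qed.

Lemma slope_norm_weightsD l l' b :
  slope_norm (l + l') b = slope_norm l b + slope_norm l' b.
Proof. by rewrite -big_split; apply: eq_bigr => i _; rewrite mxE mulrDl. Qed.

Lemma slope_norm_weightsZ c l b : slope_norm (c *: l) b = c * slope_norm l b.
Proof. by rewrite mulr_sumr; apply: eq_bigr => i _; rewrite mxE mulrA. Qed.

Lemma slope_norm_lipschitz l a b : slope_weights l ->
  `|slope_norm l a - slope_norm l b| <= norm1 l * norm1 (a - b).
Proof.
move=> lw; wlog ab : a b / slope_norm l b <= slope_norm l a.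
  move=> H; have [/H//|/ltW/H] := leP (slope_norm l b) (slope_norm l a).
  by rewrite distrC -(opprB a b) norm1N.
rewrite ger0_norm ?subr_ge0// lerBlDl.
rewrite -[X in slope_norm l X <= _](subrKC b).
apply: le_trans (slope_normD_le l b (a - b) lw) _.
by rewrite lerD2l (le_trans (ler_norm _))// slope_norm_bound.
Qed.

Definition midpoint a b : 'cV[R]_p := let h : R := 2^-1 in h *: (a + b).

Lemma slope_norm_midpoint l a b : slope_weights l ->
  slope_norm l (midpoint a b) <= 2^-1 * (slope_norm l a + slope_norm l b).
Proof.
move=> lw; apply: le_trans (slope_normZ_le l _ _ lw) _.
by rewrite ger0_norm ?invr_ge0// ler_wpM2l ?invr_ge0// slope_normD_le.
Qed.

End SlopeNorm.

(** * Quadratic forms *)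

Section QuadraticForm.
Context {p : nat}.
Implicit Types (C : 'M[R]_p) (v w : 'cV[R]_p).

Definition bil {m n} (u : 'cV[R]_m) (D : 'M[R]_(m, n)) (v : 'cV[R]_n) : R :=
  (u^T *m D *m v) 0 0.

Lemma bilE {m n} (u : 'cV[R]_m) (D : 'M[R]_(m, n)) (v : 'cV[R]_n) :
  bil u D v = \sum_i \sum_j u i 0 * D i j * v j 0.
Proof.
rewrite /bil mxE exchange_big; apply: eq_bigr => j _ /=.
by rewrite mxE mulr_suml; apply: eq_bigr => i _; rewrite mxE.
Qed.

Lemma bil_bound {m n} (u : 'cV[R]_m) (D : 'M[R]_(m, n)) (v : 'cV[R]_n) :
  `|bil u D v| <= (\sum_i \sum_j `|D i j|) * (norm1 u * norm1 v).
Proof.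
rewrite bilE mulr_suml; apply: le_trans (ler_norm_sum _ _ _) _.
apply: ler_sum => i _; rewrite mulr_suml.
apply: le_trans (ler_norm_sum _ _ _) _.
apply: ler_sum => j _; rewrite !normrM mulrAC mulrC ler_wpM2l//.
by rewrite ler_pM// coord_le_norm1.
Qed.

Lemma bilBl {m n} (u v : 'cV[R]_m) (D : 'M[R]_(m, n)) (w : 'cV[R]_n) :
  bil (u - v) D w = bil u D w - bil v D w.
Proof. by rewrite /bil [(_ - _)^T]linearB/= !mulmxBl !mxE. Qed.

Lemma bilBr {m n} (u : 'cV[R]_m) (D : 'M[R]_(m, n)) (v w : 'cV[R]_n) :
  bil u D (v - w) = bil u D v - bil u D w.
Proof. by rewrite /bil mulmxBr !mxE. Qed.

Lemma bilDl {m n} (u v : 'cV[R]_m) (D : 'M[R]_(m, n)) (w : 'cV[R]_n) :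
  bil (u + v) D w = bil u D w + bil v D w.
Proof. by rewrite /bil [(_ + _)^T]linearD/= !mulmxDl !mxE. Qed.

Lemma bilDr {m n} (u : 'cV[R]_m) (D : 'M[R]_(m, n)) (v w : 'cV[R]_n) :
  bil u D (v + w) = bil u D v + bil u D w.
Proof. by rewrite /bil mulmxDr !mxE. Qed.

Lemma bilZl {m n} c (u : 'cV[R]_m) (D : 'M[R]_(m, n)) (v : 'cV[R]_n) :
  bil (c *: u) D v = c * bil u D v.
Proof. by rewrite /bil [(_ *: _)^T]linearZ/= -!scalemxAl [LHS]mxE. Qed.

Lemma bilZr {m n} c (u : 'cV[R]_m) (D : 'M[R]_(m, n)) (v : 'cV[R]_n) :
  bil u D (c *: v) = c * bil u D v.
Proof. by rewrite /bil -scalemxAr [LHS]mxE. Qed.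

Lemma bil_tr {m n} (u : 'cV[R]_m) (D : 'M[R]_(m, n)) (v : 'cV[R]_n) :
  bil u D v = bil v D^T u.
Proof.
rewrite /bil -[in LHS](trmxK (u^T *m D *m v)) [LHS]mxE !trmx_mul trmxK.
by rewrite mulmxA.
Qed.

Lemma bil_sub_sqr C v w : C^T = C ->
  bil (v - w) C (v - w) = bil v C v - 2 * bil w C v + bil w C w.
Proof. by move=> CT; rewrite bilBl !bilBr (bil_tr v C w) CT; ring. Qed.

Lemma bil_add_sqr C v w : C^T = C ->
  bil (v + w) C (v + w) = bil v C v + 2 * bil w C v + bil w C w.
Proof. by move=> CT; rewrite bilDl !bilDr (bil_tr v C w) CT; ring. Qed.

Lemma posdef_bil_ge0 C v : posdef C -> 0 <= bil v C v.
Proof.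
move=> [_ C0]; have [->|/C0/ltW//] := eqVneq v 0.
by rewrite /bil mulmx0 mxE.
Qed.

Lemma posdef_cauchy_schwarz C v w : posdef C ->
  bil w C v ^+ 2 <= bil w C w * bil v C v.
Proof.
move=> Cpd; have [->|w0] := eqVneq w 0.
  by rewrite /bil trmx0 !mul0mx mxE expr0n mul0r.
have q0 : 0 < bil w C w by exact: Cpd.2.
(* v - (b / q) w is the component of v orthogonal to w. *)
set b := bil w C v; set q := bil w C w in q0 *.
have := posdef_bil_ge0 C (v - (b / q) *: w) Cpd.
rewrite bil_sub_sqr ?Cpd.1// !bilZl bilZr.
rewrite -/q -/b => /(mulr_ge0 (ltW q0)).
rewrite [X in 0 <= X](_ : _ = q * bil v C v - b ^+ 2) ?subr_ge0//.
by field; rewrite gt_eqF.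
Qed.

Lemma posdef_unit C : posdef C -> C \in unitmx.
Proof.
move=> [CT C0]; rewrite -row_free_unit -kermx_eq0; apply/eqP/row_matrixP => i.
rewrite row0; apply/eqP/negP => /negP u0.
have uC : row i (kermx C) *m C = 0 by apply/sub_kermxP; exact: row_sub.
have := C0 (row i (kermx C))^T.
rewrite trmxK uC mul0mx mxE ltxx => /(_ _)/negP; apply => //.
by rewrite -(inj_eq (@trmx_inj _ _ _)) trmxK trmx0.
Qed.

(** A positive definite form dominates the Euclidean norm. Each coordinate is
    v_j = <C^-1 e_j, v> for the inner product defined by C, so Cauchy-Schwarz
    bounds its square by (C^-1)_jj times the form at v: the constant is the
    trace of C^-1. *)
Lemma posdef_coercive C : posdef C ->
  exists2 K : R, 0 < K & forall v, l2norm v ^+ 2 <= K * bil v C v.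
Proof.
move=> Cpd; have CU := posdef_unit C Cpd.
pose w (j : 'I_p) : 'cV[R]_p := invmx C *m delta_mx j 0.
have wv j v : bil (w j) C v = v j 0.
  rewrite /bil /w trmx_mul trmx_inv Cpd.1 -!mulmxA mulKmx//.
  by rewrite trmx_delta -rowE mxE.
exists (1 + \sum_j bil (w j) C (w j)).
  by rewrite ltr_pwDl// sumr_ge0// => j _; exact: posdef_bil_ge0.
move=> v; rewrite sqr_l2norm mulrDl mul1r.
apply: le_trans (_ : _ <= (\sum_j bil (w j) C (w j)) * bil v C v) _;
  last by rewrite lerDr posdef_bil_ge0.
rewrite mulr_suml; apply: ler_sum => j _; rewrite -wv.
exact: posdef_cauchy_schwarz.
Qed.

End QuadraticForm.

(** * The limit problem *)

Section LimitProblem.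
Context {p : nat} (C : 'M[R]_p) (b0 l : 'cV[R]_p).
Hypotheses (C_posdef : posdef C) (l_weights : slope_weights l).
Let Z := slope_limit C b0 l.

(** Strong convexity at the midpoint: the parallelogram law for the quadratic
    part, plain convexity for the SLOPE norm. *)
Lemma slope_limit_midpoint (a b : 'cV[R]_p) :
  Z (midpoint a b) <= 2^-1 * (Z a + Z b) - 8^-1 * bil (a - b) C (a - b).
Proof.
have ZE u : Z u = 2^-1 * bil (u - b0) C (u - b0) + slope_norm l u by [].
rewrite !ZE.
have J := slope_norm_midpoint l a b l_weights.
have CT := C_posdef.1.
set v := a - b0; set w := b - b0.
have -> : midpoint a b - b0 = midpoint v w.
  by apply/matrixP => i j; rewrite !mxE; lra.
have -> : a - b = v - w by rewrite /v /w opprB addrA subrK.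
rewrite (bilZl 2^-1 (v + w) C) (bilZr 2^-1 _ C (v + w)).
rewrite bil_sub_sqr// bil_add_sqr//.
by lra.
Qed.

Lemma slope_limit_ge0 b : 0 <= Z b.
Proof.
rewrite addr_ge0// ?slope_norm_ge0// mulr_ge0 ?invr_ge0//.
exact: (posdef_bil_ge0 C _ C_posdef).
Qed.

(** Compare a with the midpoint of a and b, where Z is at least Z a. *)
Lemma slope_limit_growth (a b : 'cV[R]_p) : argmin Z a ->
  4^-1 * bil (b - a) C (b - a) <= Z b - Z a.
Proof.
move=> Za; have := slope_limit_midpoint b a; have := Za (midpoint b a).
by lra.
Qed.

Lemma slope_limit_argmin_unique (a b : 'cV[R]_p) :
  argmin Z a -> argmin Z b -> b = a.
Proof.
move=> Za Zb; have := slope_limit_growth a b Za; have := Zb a.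
move=> Zba; have [/eqP|ba] := eqVneq (b - a) 0.
  by rewrite subr_eq0 => /eqP.
have {ba} : 0 < bil (b - a) C (b - a) by exact: C_posdef.2.
by move=> *; exfalso; lra.
Qed.

Lemma slope_limit_cvg (b : nat -> 'cV[R]_p) (a : 'cV[R]_p) :
  (forall j, (fun n => b n j 0) @ \oo --> a j 0) ->
  (fun n => Z (b n)) @ \oo --> Z a.
Proof.
move=> ba; apply: cvgD.
  have E v : ((v - b0)^T *m C *m (v - b0)) 0 0 =
      \sum_i \sum_j (v i 0 - b0 i 0) * C i j * (v j 0 - b0 j 0).
    rewrite -/(bil _ _ _) bilE; apply: eq_bigr => i _; apply: eq_bigr => j _.
    by rewrite !mxE.
  apply: cvgM; first exact: cvg_cst.
  rewrite E; under eq_fun do rewrite E.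
  apply: cvg_sumr => i; apply: cvg_sumr => j.
  apply: cvgM; [apply: cvgM; last exact: cvg_cst|];
    by apply: cvgB; [exact: ba|exact: cvg_cst].
have N1 : (fun n => norm1 (a - b n)) @ \oo --> (0 : R).
  have aj j : (fun n => `|(a - b n) j 0|) @ \oo --> (0 : R).
    rewrite (_ : (fun n => _) = (fun n => `|a j 0 - b n j 0|)); last first.
      by apply/funext => n; rewrite !mxE.
    have -> : (0 : R) = `|a j 0 - a j 0| by rewrite subrr normr0.
    by apply: cvg_norm; apply: cvgB; [exact: cvg_cst|exact: ba].
  by have := cvg_sumr (index_enum _) _ _ aj; rewrite big1.
have N0 : (fun n => norm1 l * norm1 (a - b n)) @ \oo --> (0 : R).
  rewrite -[X in _ --> X](mulr0 (norm1 l)).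
  by apply: cvgM => //; exact: cvg_cst.
apply/cvgrPdist_le => e e0.
move/cvgrPdist_le : N0 => /(_ e e0); apply: filterS => n.
rewrite sub0r normrN => /(le_trans (ler_norm _)); apply: le_trans.
exact: slope_norm_lipschitz.
Qed.

(** Strong convexity makes every minimising sequence Cauchy, so its
    coordinatewise limit is a minimiser. *)
Lemma slope_limit_argmin_exists : exists a, argmin Z a.
Proof.
have [K K0 KC] := posdef_coercive C C_posdef.
pose m := inf (range Z).
have hi : has_inf (range Z).
  split; first by exists (Z 0); exists 0.
  by exists 0 => _ [b _ <-]; exact: slope_limit_ge0.
have m_le b : m <= Z b by apply: ge_inf; [exact: hi.2|exists b].
have /choice[b Zb] : forall n : nat, exists b, Z b < m + n.+1%:R^-1.
  move=> n; have n0 : 0 < n.+1%:R^-1 :> R by rewrite invr_gt0 ltr0n.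
  by have [_ [b _ <-] H] := inf_adherent n0 hi; exists b.
have close e : 0 < e -> \forall n \near \oo, forall k, (n <= k)%N ->
    l2norm (b n - b k) ^+ 2 <= e.
  move=> e0; near=> n => k nk.
  have n0 : 0 < n.+1%:R :> R by rewrite ltr0n.
  have kn : k.+1%:R^-1 <= n.+1%:R^-1 :> R.
    by rewrite lef_pV2 ?posrE ?ltr0n// ler_nat.
  have := slope_limit_midpoint (b n) (b k).
  have := m_le (midpoint (b n) (b k)).
  have := Zb n; have := Zb k => H1 H2 H3 H4.
  apply: le_trans (KC _) _.
  apply: (@le_trans _ _ (K * (8 * n.+1%:R^-1))).
    rewrite ler_pM2l//; move: H1 H2 H3 H4 kn; rewrite -/Z.
    move: (k.+1%:R^-1) (n.+1%:R^-1) => u w; lra.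
  rewrite mulrA ler_pdivrMr// [e * _]mulrC -ler_pdivrMr//.
  apply: (@le_trans _ _ n%:R); last by rewrite ler_nat.
  by near: n; exact: nbhs_infty_ger.
have coord_cvg j : cvg ((fun n => b n j 0) @ \oo).
  apply/cauchy_cvgP/cauchy_exP => e e0 /=.
  have e20 : 0 < (e / 2) ^+ 2 by rewrite exprn_gt0// divr_gt0.
  have [N _ /(_ N (leqnn N)) NE] := close _ e20.
  exists (b N j 0); exists N => //= k /NE.
  rewrite ler_pXn2r ?nnegrE ?sqrtr_ge0 ?divr_ge0 ?(ltW e0)// => H.
  rewrite /ball /=; apply: le_lt_trans (_ : e / 2 < e); last by lra.
  apply: le_trans H.
  rewrite -(@ler_pXn2r _ 2)// ?nnegrE ?sqrtr_ge0// real_normK ?num_real//.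
  rewrite sqr_l2norm (bigD1 j)//= !mxE lerDl sumr_ge0// => i _; exact: sqr_ge0.
pose a : 'cV[R]_p := \col_j lim ((fun n => b n j 0) @ \oo).
exists a => b'; apply: le_trans (m_le b').
have Za : (fun n => Z (b n)) @ \oo --> Z a.
  by apply: slope_limit_cvg => j; rewrite mxE; exact: coord_cvg.
have mh : (fun n => m + n.+1%:R^-1) @ \oo --> m.
  rewrite -[X in _ --> X]addr0; apply: cvgD; first exact: cvg_cst.
  exact: cvg_harmonic.
rewrite -(cvg_lim (@Rhausdorff R) mh) -(cvg_lim (@Rhausdorff R) Za).
apply: ler_lim.
- by apply/cvg_ex; exists (Z a).
- by apply/cvg_ex; exists m.
- by apply: nearW => n; have := ltW (Zb n).
Unshelve. all: by end_near. Qed.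

(** * Stability of the minimiser *)

Lemma l2norm_bil {n} (v : 'cV[R]_n) : l2norm v ^+ 2 = bil v 1%:M v.
Proof.
rewrite sqr_l2norm /bil mulmx1 mxE; apply: eq_bigr => i _.
by rewrite mxE expr2.
Qed.

(** The objective depends on the sample only through the empirical covariance
    n^-1 X^T X and the score n^-1 X^T e, up to a term that is constant in b. *)
Lemma slope_objective_scaled {n} (X : 'M[R]_(n, p)) (e : 'cV[R]_n)
    (l' b : 'cV[R]_p) :
  n%:R^-1 * slope_objective X (X *m b0 + e) l' b =
  n%:R^-1 * (2^-1 * l2norm e ^+ 2) +
  (2^-1 * bil (b - b0) (n%:R^-1 *: (X^T *m X)) (b - b0) -
   ((b - b0)^T *m (n%:R^-1 *: (X^T *m e))) 0 0 +
   slope_norm (n%:R^-1 *: l') b).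
Proof.
rewrite /slope_objective slope_norm_weightsZ.
have -> : X *m b0 + e - X *m b = e - X *m (b - b0).
  by rewrite mulmxBr opprB addrAC addrC.
set h := b - b0; set c := n%:R^-1.
rewrite [in LHS]l2norm_bil bil_sub_sqr ?trmx1// -l2norm_bil.
have -> : bil (X *m h) 1%:M e = (h^T *m (X^T *m e)) 0 0.
  by rewrite /bil mulmx1 trmx_mul mulmxA.
have -> : bil (X *m h) 1%:M (X *m h) = bil h (X^T *m X) h.
  by rewrite /bil mulmx1 trmx_mul !mulmxA.
have -> : bil h (c *: (X^T *m X)) h = c * bil h (X^T *m X) h.
  by rewrite /bil -scalemxAr -scalemxAl [LHS]mxE.
have -> : (h^T *m (c *: (X^T *m e))) 0 0 = c * (h^T *m (X^T *m e)) 0 0.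
  by rewrite -scalemxAr [LHS]mxE.
by field.
Qed.

Lemma dot_bound (u v : 'cV[R]_p) : `|(u^T *m v) 0 0| <= norm1 v * norm1 u.
Proof.
rewrite mxE /norm1 mulr_suml; apply: le_trans (ler_norm_sum _ _ _) _.
apply: ler_sum => i _; rewrite mxE normrM mulrC ler_wpM2l//.
exact: coord_le_norm1.
Qed.

(** Deterministic core of consistency: a minimiser b of the empirical objective
    satisfies Z b - Z a <= O(delta) (1 + |b - a|)^2, where delta bounds the
    sampling errors, while strong convexity gives Z b - Z a >= c |b - a|^2. *)
Lemma slope_stability (a : 'cV[R]_p) (eta : R) : argmin Z a -> 0 < eta ->
  exists2 delta : R, 0 < delta &
  forall n (X : 'M[R]_(n, p)) (e : 'cV[R]_n) (l' b : 'cV[R]_p),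
    \sum_j \sum_k `|(n%:R^-1 *: (X^T *m X)) j k - C j k| <= delta ->
    \sum_j `|(n%:R^-1 *: (X^T *m e)) j 0| <= delta ->
    norm1 (n%:R^-1 *: l' - l) <= delta ->
    argmin (slope_objective X (X *m b0 + e) l') b ->
    l2norm (b - a) <= eta.
Proof.
move=> Za eta0; have [K K0 KC] := posdef_coercive C C_posdef.
set A : R := 1 + norm1 (a - b0) + norm1 a.
have A1 : 1 <= A by rewrite /A -addrA lerDl addr_ge0// norm1_ge0.
have pA0 : 0 < p%:R * eta + A by rewrite ltr_wpDl ?mulr_ge0 ?(ltW eta0)//; lra.
(* The slope s is small enough for x <= s (p x + A) to force x <= eta. *)
pose s := eta / (2 * (p%:R * eta + A)).
have s0 : 0 < s by rewrite divr_gt0// mulr_gt0.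
have sE x : 0 <= x -> s * (p%:R * x + A) <= 2^-1 * x + 2^-1 * eta.
  move=> x0; rewrite /s mulrAC ler_pdivrMr ?mulr_gt0// -subr_ge0.
  rewrite [X in 0 <= X](_ : _ = p%:R * eta * eta + A * x); last by field.
  by rewrite addr_ge0// !mulr_ge0// ?(ltW eta0)//; lra.
exists (s ^+ 2 / (20 * K)); first by rewrite divr_gt0 ?exprn_gt0// mulr_gt0.
(* With this delta, K times the comparison of Z b with Z a reads
   L ^+ 2 <= s ^+ 2 * (u + A) ^+ 2. *)
set delta := _ / _ => n X e l' b.
set G := _ *: (X^T *m X); set W := _ *: (X^T *m e); set r := _ *: l'.
move=> DG DW Dl bmin.
have nobj : n%:R^-1 * slope_objective X (X *m b0 + e) l' b <=
    n%:R^-1 * slope_objective X (X *m b0 + e) l' a.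
  by rewrite ler_wpM2l ?invr_ge0//; exact: bmin.
rewrite !slope_objective_scaled -/G -/W -/r lerD2l in nobj.
set u := norm1 (b - a); set L := l2norm (b - a).
have u0 : 0 <= u := norm1_ge0 _.
have L0 : 0 <= L := sqrtr_ge0 _.
have uL : u <= p%:R * L := norm1_le_l2norm _.
have d0 : 0 <= delta by apply: le_trans Dl; exact: norm1_ge0.
(* Both points lie within u + A of 0 and of b0. *)
have small (v : 'cV[R]_p) : norm1 (v - b0) <= u + A -> norm1 v <= u + A ->
    `|2^-1 * bil (v - b0) (G - C) (v - b0) - ((v - b0)^T *m W) 0 0 +
      slope_norm (r - l) v| <= delta * (5 / 2 * (u + A) ^+ 2).
  move=> v1 v2; have uA1 : 1 <= u + A by lra.
  have uA2 : u + A <= (u + A) ^+ 2 by rewrite expr2 ler_peMr//; lra.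
  have B1 : `|bil (v - b0) (G - C) (v - b0)| <= delta * (u + A) ^+ 2.
    apply: le_trans (bil_bound _ _ _) _.
    rewrite ler_pM ?mulr_ge0 ?norm1_ge0//.
    - by apply: sumr_ge0 => i _; apply: sumr_ge0.
    - apply: le_trans DG; apply: ler_sum => i _; apply: ler_sum => j _.
      by rewrite [(G - C) i j]mxE [(- C) i j]mxE.
    - by rewrite expr2 ler_pM ?norm1_ge0.
  have B2 : `|((v - b0)^T *m W) 0 0| <= delta * (u + A) ^+ 2.
    apply: le_trans (dot_bound _ _) _; rewrite ler_pM ?norm1_ge0//.
    exact: le_trans uA2.
  have B3 : `|slope_norm (r - l) v| <= delta * (u + A) ^+ 2.
    apply: le_trans (slope_norm_bound _ _) _; rewrite ler_pM ?norm1_ge0//.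
    exact: le_trans uA2.
  move: B1 B2 B3; rewrite !ler_norml => /andP[? ?] /andP[? ?] /andP[? ?].
  by apply/andP; split; lra.
have ZE (v : 'cV[R]_p) : 2^-1 * bil (v - b0) G (v - b0) -
    ((v - b0)^T *m W) 0 0 + slope_norm r v = Z v +
    (2^-1 * bil (v - b0) (G - C) (v - b0) - ((v - b0)^T *m W) 0 0 +
      slope_norm (r - l) v).
  have -> : Z v = 2^-1 * bil (v - b0) C (v - b0) + slope_norm l v by [].
  have -> : bil (v - b0) G (v - b0) =
      bil (v - b0) C (v - b0) + bil (v - b0) (G - C) (v - b0).
    rewrite !bilE -big_split; apply: eq_bigr => i _ /=.
    rewrite -big_split; apply: eq_bigr => j _ /=.
    by rewrite [(G - C) i j]mxE [(- C) i j]mxE; ring.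
  have -> : slope_norm r v = slope_norm l v + slope_norm (r - l) v.
    by rewrite -slope_norm_weightsD subrKC.
  by ring.
rewrite !ZE in nobj.
have nab0 : norm1 (a - b0) <= u + A by have := norm1_ge0 a; rewrite /A; lra.
have na : norm1 a <= u + A by have := norm1_ge0 (a - b0); rewrite /A; lra.
have nbb0 : norm1 (b - b0) <= u + A.
  have -> : b - b0 = (b - a) + (a - b0) by rewrite addrA subrK.
  apply: le_trans (norm1D_le _ _) _; rewrite lerD2l /A.
  by have := norm1_ge0 a; lra.
have nb : norm1 b <= u + A.
  rewrite -[b](subrK a); apply: le_trans (norm1D_le _ _) _; rewrite lerD2l /A.
  by have := norm1_ge0 (a - b0); lra.
have := small a nab0 na; have := small b nbb0 nb.
rewrite !ler_norml => /andP[Hb _] /andP[_ Ha].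
have grow := slope_limit_growth a b Za.
have Zba : Z b - Z a <= delta * (5 * (u + A) ^+ 2) by move: nobj Ha Hb; lra.
have L2 : L ^+ 2 <= (s * (p%:R * L + A)) ^+ 2.
  apply: le_trans (KC _) _.
  apply: (@le_trans _ _ (K * (20 * (delta * (u + A) ^+ 2)))).
    by rewrite ler_pM2l//; move: Zba grow; lra.
  rewrite exprMn [X in X <= _](_ : _ = s ^+ 2 * (u + A) ^+ 2); last first.
    by rewrite /delta; field; rewrite gt_eqF.
  rewrite ler_pM2l ?exprn_gt0// ler_pXn2r ?nnegrE ?lerD2r//; lra.
have : L <= s * (p%:R * L + A).
  rewrite -(@ler_pXn2r _ 2)// nnegrE mulr_ge0 ?(ltW s0)//.
  by rewrite addr_ge0 ?mulr_ge0//; lra.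
by have := sE L L0; lra.
Qed.

End LimitProblem.

End Deterministic.

(** * Expectations of real functions *)

Section Expectation.
Context {d : measure_display} {T : measurableType d} {R : realType}
  (P : probability T R).
Implicit Types F G : T -> R.

Definition mean F : R := fine 'E_P[F].

Lemma integrable_measurable {F} : F \in Lfun P 1 -> measurable_fun setT F.
Proof. by move=> /Lfun1_integrable/integrableP[/measurable_EFinP]. Qed.

Lemma integrableD {F G} : F \in Lfun P 1 -> G \in Lfun P 1 ->
  (fun t => F t + G t) \in Lfun P 1.
Proof. exact: rpredD. Qed.

Lemma integrableB {F G} : F \in Lfun P 1 -> G \in Lfun P 1 ->
  (fun t => F t - G t) \in Lfun P 1.
Proof. exact: rpredB. Qed.

Lemma integrableZ {F} a : F \in Lfun P 1 -> (fun t => a * F t) \in Lfun P 1.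
Proof.
move=> iF; rewrite (_ : (fun t => _) = a \o* F); last first.
  by apply/funext => t /=; rewrite mulrC.
exact: Lfun_scale.
Qed.

Lemma integrable_norm {F} : F \in Lfun P 1 -> (fun t => `|F t|) \in Lfun P 1.
Proof. exact: Lfun_norm. Qed.

Lemma integrable_cst a : (fun _ => a) \in Lfun P 1.
Proof. exact: Lfun_cst. Qed.

Lemma integrable_sum {I : Type} (r : seq I) (F : I -> T -> R) :
  (forall i, F i \in Lfun P 1) -> (fun t => \sum_(i <- r) F i t) \in Lfun P 1.
Proof.
move=> iF; elim: r => [|i r IH].
  by under eq_fun do rewrite big_nil; exact: integrable_cst.
by under eq_fun do rewrite big_cons; exact: integrableD.
Qed.

Lemma le_integrable_Lfun {F G} : measurable_fun setT F -> G \in Lfun P 1 ->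
  (forall t, `|F t| <= `|G t|) -> F \in Lfun P 1.
Proof.
move=> mF /Lfun1_integrable iG FG; apply/Lfun1_integrable.
apply: (le_integrable _ _ _ iG) => //; first exact/measurable_EFinP.
by move=> t _ /=; rewrite lee_fin.
Qed.

Lemma mean_fineK {F} : F \in Lfun P 1 -> (mean F)%:E = 'E_P[F]%E.
Proof. by move=> iF; rewrite fineK// expectation_fin_num. Qed.

Lemma meanD {F G} : F \in Lfun P 1 -> G \in Lfun P 1 ->
  mean (fun t => F t + G t) = mean F + mean G.
Proof.
move=> iF iG; rewrite /mean (_ : (fun t => _) = F \+ G)// expectationD//.
by rewrite fineD// expectation_fin_num.
Qed.

Lemma mean_cst a : mean (fun _ => a) = a.
Proof. by rewrite /mean -[fun _ => a]/(cst a) expectation_cst. Qed.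

Lemma meanZ {F} a : F \in Lfun P 1 -> mean (fun t => a * F t) = a * mean F.
Proof.
move=> iF; rewrite /mean (_ : (fun t => _) = a \o* F); last first.
  by apply/funext => t /=; rewrite mulrC.
by rewrite expectationZl// fineM// expectation_fin_num.
Qed.

Lemma meanB {F G} : F \in Lfun P 1 -> G \in Lfun P 1 ->
  mean (fun t => F t - G t) = mean F - mean G.
Proof.
move=> iF iG; rewrite /mean (_ : (fun t => _) = F \- G)// expectationB//.
by rewrite fineB// expectation_fin_num.
Qed.

Lemma mean_sum {I : Type} (r : seq I) (F : I -> T -> R) :
  (forall i, F i \in Lfun P 1) ->
  mean (fun t => \sum_(i <- r) F i t) = \sum_(i <- r) mean (F i).
Proof.
move=> iF; elim: r => [|i r IH].
  by under eq_fun do rewrite big_nil; rewrite mean_cst big_nil.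
under eq_fun do rewrite big_cons.
by rewrite meanD ?IH ?big_cons//; exact: integrable_sum.
Qed.

Lemma le_mean {F G} : F \in Lfun P 1 -> G \in Lfun P 1 ->
  (forall t, F t <= G t) -> mean F <= mean G.
Proof.
move=> iF iG FG; rewrite -lee_fin !mean_fineK// unlock.
apply: le_integral => //; try exact/Lfun1_integrable.
by move=> t _; rewrite lee_fin.
Qed.

Lemma mean_ge0 {F} : (forall t, 0 <= F t) -> 0 <= mean F.
Proof. by move=> F0; rewrite fine_ge0// expectation_ge0. Qed.

Lemma norm_mean_le {F} : F \in Lfun P 1 -> `|mean F| <= mean (fun t => `|F t|).
Proof.
move=> iF; have iN := integrable_norm iF.
rewrite ler_norml; apply/andP; split.
  rewrite lerNl -mulN1r -meanZ//.
  apply: le_mean => //; first exact: integrableZ.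
  by move=> t; rewrite mulN1r ler_normr lexx orbT.
by apply: le_mean => // t; exact: ler_norm.
Qed.

(** Product measures are determined by their values on rectangles, so by
    independence the joint law of F and G is the product of their laws, and
    Fubini's theorem applies. *)
Lemma mean_mul_independent {F G} : F \in Lfun P 1 -> G \in Lfun P 1 ->
  (forall A B, measurable A -> measurable B ->
    P (F @^-1` A `&` G @^-1` B) = (P (F @^-1` A) * P (G @^-1` B))%E) ->
  (fun t => F t * G t) \in Lfun P 1 /\
  mean (fun t => F t * G t) = mean F * mean G.
Proof.
move=> iF iG FG.
have mF := integrable_measurable iF; have mG := integrable_measurable iG.
pose F' : {mfun T >-> R} := HB.pack F (isMeasurableFun.Build _ _ _ _ _ mF).
pose G' : {mfun T >-> R} := HB.pack G (isMeasurableFun.Build _ _ _ _ _ mG).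
pose H t := (F t, G t).
have mH : measurable_fun setT H by exact: measurable_fun_pair.
pose H' : {mfun T >-> (R * R)%type} :=
  HB.pack H (isMeasurableFun.Build _ _ _ _ _ mH).
pose m1 := distribution P F'; pose m2 := distribution P G'.
have mE A : measurable A -> A `<=` setT ->
    (distribution P H' : set _ -> _) A = (m1 \x m2)%E A.
  move=> mA _; apply/esym/product_measure_unique => //.
have mm : measurable_fun setT (fun z : R * R => (z.1 * z.2)%:E).
  by apply/measurable_EFinP; exact: measurable_funM.
have mN : measurable_fun setT (fun x : R => `|x|%:E).
  by apply/measurable_EFinP; exact: normr_measurable.
have EN (K : {mfun T >-> R}) : (K : T -> R) \in Lfun P 1 ->
    (\int[distribution P K]_x `|x|%:E)%E = (mean (fun t => `|K t|))%:E.
  move=> iK; rewrite ge0_integral_distribution// mean_fineK ?integrable_norm//.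
  by rewrite unlock.
have meanE (K : {mfun T >-> R}) : (K : T -> R) \in Lfun P 1 ->
    (\int[distribution P K]_x x%:E)%E = (mean K)%:E.
  move=> iK; rewrite integral_distribution//.
  - by rewrite mean_fineK// unlock.
  - exact/Lfun1_integrable.
have iprod : (m1 \x m2)%E.-integrable setT (fun z => (z.1 * z.2)%:E).
  apply/integrable12ltyP => //=.
  under eq_integral.
    move=> x _.
    under eq_integral do rewrite normrM EFinM.
    rewrite ge0_integralZl// EN//.
    over.
  rewrite ge0_integralZr//; last by rewrite lee_fin mean_ge0.
  by rewrite EN// -EFinM ltry.
have iH : (distribution P H').-integrable setT (fun z => (z.1 * z.2)%:E).
  move/integrableP : iprod => [_ iprod]; apply/integrableP; split=> //.
  rewrite (eq_measure_integral (m1 \x m2)%E)//.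
have iFG : (fun t => F t * G t) \in Lfun P 1.
  apply/Lfun1_integrable/integrableP; split.
    by apply/measurable_EFinP; exact: measurable_funM.
  move/integrableP : iH => [_]; rewrite ge0_integral_distribution//.
  exact: measurableT_comp.
split=> //; apply: EFin_inj; rewrite mean_fineK// unlock.
rewrite -(@integral_distribution _ _ _ _ _ P H'
  (fun z => (z.1 * z.2)%:E))//; last first.
  exact/Lfun1_integrable.
rewrite (eq_measure_integral (m1 \x m2)%E)//.
rewrite -integral12_prod_meas1//= /fubini_F /=.
under eq_integral.
  move=> x _.
  under eq_integral do rewrite EFinM.
  rewrite integralZl//; last first.
    apply: (integrable_pushforward mG) => //.
    exact/Lfun1_integrable.
  rewrite meanE//.
  over.
rewrite integralZr//; last first.
  by apply: (integrable_pushforward mF) => //; exact/Lfun1_integrable.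
by rewrite meanE// -EFinM.
Qed.


(** * Weak laws of large numbers in mean *)

Definition vanishes_in_mean (Z : nat -> T -> R) : Prop :=
  (forall n, Z n \in Lfun P 1) /\
  (fun n => mean (fun t => `|Z n t|)) @ \oo --> (0 : R).

Lemma vanishes_in_meanP (Z : nat -> T -> R) : (forall n, Z n \in Lfun P 1) ->
  (forall e : R, 0 < e ->
    \forall n \near \oo, mean (fun t => `|Z n t|) <= e) ->
  vanishes_in_mean Z.
Proof.
move=> iZ Ze; split=> //; apply/cvgrPdist_le => e /Ze; apply: filterS => n Zn.
by rewrite sub0r normrN ger0_norm// mean_ge0.
Qed.

Lemma vanishes_in_mean_le (Z : nat -> T -> R) (e : R) : vanishes_in_mean Z ->
  0 < e -> \forall n \near \oo, mean (fun t => `|Z n t|) <= e.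
Proof.
move=> [_ /cvgrPdist_le Z0] /Z0; apply: filterS => n.
by rewrite sub0r normrN => /(le_trans (ler_norm _)).
Qed.

Lemma vanishes_in_mean_sum_norm {I : Type} (r : seq I)
    (Z : I -> nat -> T -> R) : (forall i, vanishes_in_mean (Z i)) ->
  vanishes_in_mean (fun n t => \sum_(i <- r) `|Z i n t|).
Proof.
move=> Z0; have iN i n := integrable_norm ((Z0 i).1 n); split.
  by move=> n; apply: integrable_sum => i.
have -> : (fun n => mean (fun t => `|\sum_(i <- r) `|Z i n t| |)) =
    (fun n => \sum_(i <- r) mean (fun t => `|Z i n t|)).
  apply/funext => n; rewrite -mean_sum//; congr mean; apply/funext => t.
  by rewrite ger0_norm// sumr_ge0.
by have := cvg_sumr r _ _ (fun i => (Z0 i).2); rewrite big1.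
Qed.

Definition average (Y : nat -> T -> R) (n : nat) (t : T) : R :=
  n%:R^-1 * \sum_(i < n) Y i t.

Lemma integrable_average (Y : nat -> T -> R) n :
  (forall i, Y i \in Lfun P 1) -> average Y n \in Lfun P 1.
Proof. by move=> iY; apply: integrableZ; apply: integrable_sum => i. Qed.

(** Orthogonality leaves only the diagonal terms of the second moment, which is
    therefore at most c / n. *)
Lemma average_orthogonal (Y : nat -> T -> R) (c : R) :
  (forall i, Y i \in Lfun P 1) ->
  (forall i k, (fun t => Y i t * Y k t) \in Lfun P 1) ->
  (forall i k, i != k -> mean (fun t => Y i t * Y k t) = 0) ->
  (forall i, mean (fun t => Y i t * Y i t) <= c) ->
  vanishes_in_mean (average Y).
Proof.
move=> iY iYY oY cY; apply: vanishes_in_meanP => [n|e e0].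
  exact: integrable_average.
have sqE n : (fun t => average Y n t ^+ 2) =
    (fun t => n%:R^-1 ^+ 2 * \sum_(i < n) \sum_(k < n) Y i t * Y k t).
  by apply/funext => t; rewrite /average exprMn [X in _ * X]expr2 big_distrlr.
have isq n : (fun t => average Y n t ^+ 2) \in Lfun P 1.
  rewrite sqE; apply: integrableZ; apply: integrable_sum => i.
  exact: integrable_sum.
have sq_le n : (0 < n)%N -> mean (fun t => average Y n t ^+ 2) <= c / n%:R.
  move=> n0; have n0' : (0 : R) < n%:R by rewrite ltr0n.
  rewrite sqE meanZ; last first.
    by apply: integrable_sum => i; exact: integrable_sum.
  rewrite mean_sum; last by move=> i; exact: integrable_sum.
  have -> : \sum_(i < n) mean (fun t => \sum_(k < n) Y i t * Y k t) =
      \sum_(i < n) mean (fun t => Y i t * Y i t).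
    apply: eq_bigr => i _; rewrite mean_sum// (bigD1 i)//= big1 ?addr0// => k.
    by rewrite eq_sym => ik; exact: oY.
  apply: (@le_trans _ _ (n%:R^-1 ^+ 2 * (c * n%:R))).
    rewrite ler_wpM2l ?sqr_ge0//.
    apply: (@le_trans _ _ (\sum_(i < n) c)); first by apply: ler_sum => i _.
    by rewrite sumr_const card_ord mulr_natr.
  rewrite le_eqVlt; apply/orP; left; apply/eqP; field.
  by rewrite gt_eqF.
(* AM-GM trades the square root of the second moment for a slack of e. *)
have amgm n t : `|average Y n t| <= e / 2 + (2 * e)^-1 * average Y n t ^+ 2.
  rewrite -(real_normK (num_real (average Y n t))); set w := `|_|.
  rewrite -subr_ge0 (_ : _ - _ = (2 * e)^-1 * (w - e) ^+ 2).
    by rewrite mulr_ge0 ?sqr_ge0// invr_ge0 mulr_ge0// ltW.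
  by field; rewrite gt_eqF.
near=> n.
have n0 : (0 < n)%N by near: n; exists 1%N.
have n0' : (0 : R) < n%:R by rewrite ltr0n.
apply: (@le_trans _ _ (e / 2 + (2 * e)^-1 * (c / n%:R))).
  apply: (@le_trans _ _
      (mean (fun t => e / 2 + (2 * e)^-1 * average Y n t ^+ 2))).
    apply: le_mean => //.
    - by apply/integrable_norm/integrable_average.
    - by apply: integrableD; [exact: integrable_cst|exact: integrableZ].
  rewrite meanD ?mean_cst ?meanZ//; last 2 first.
    exact: integrable_cst.
    exact: integrableZ.
  by rewrite lerD2l ler_wpM2l ?sq_le// invr_ge0 mulr_ge0// ltW.
have : c / (e * e) <= n%:R by near: n; exact: nbhs_infty_ger.
rewrite ler_pdivrMr ?mulr_gt0// => cn.
suff : (2 * e)^-1 * (c / n%:R) <= e / 2 by lra.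
rewrite mulrCA -invfM ler_pdivrMr ?mulr_gt0//.
by apply: (le_trans cn); rewrite le_eqVlt; apply/orP; left; apply/eqP; field.
Unshelve. all: by end_near. Qed.

Definition clamp (M y : R) : R := Num.max (- M) (Num.min M y).

Lemma measurable_clamp M : measurable_fun setT (clamp M).
Proof. by apply: measurable_maxr => //; exact: measurable_minr. Qed.

Lemma norm_clamp_le (M y : R) : 0 <= M -> `|clamp M y| <= M.
Proof.
move=> M0; rewrite /clamp ler_norml le_max lexx ge_max ge_min lexx andbT /=.
by lra.
Qed.

Lemma clamp_id (M y : R) : `|y| <= M -> clamp M y = y.
Proof.
by rewrite ler_norml /clamp => /andP[h1 h2]; rewrite min_r// max_r.
Qed.

Lemma norm_sub_clamp_le (M y : R) : 0 <= M -> `|y - clamp M y| <= `|y|.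
Proof.
move=> M0; have [yM|/ltW yM] := leP `|y| M.
  by rewrite clamp_id// subrr normr0.
have [y0|/ltW y0] := leP 0 y.
  have My : M <= y by rewrite -(ger0_norm y0).
  by rewrite /clamp (min_l My) max_r ?ger0_norm; lra.
have My : M <= - y by rewrite -(ler0_norm y0).
by rewrite /clamp min_r ?max_l ?ler0_norm; lra.
Qed.

(** Dominated convergence along integer levels, with |F| dominating. *)
Lemma clamp_tail {F} (e : R) : F \in Lfun P 1 -> 0 < e ->
  exists2 M, 0 <= M & mean (fun t => `|F t - clamp M (F t)|) <= e.
Proof.
move=> iF e0; have mF := integrable_measurable iF.
pose r (n : nat) t := `|F t - clamp n%:R (F t)|.
have mr n : measurable_fun setT (r n).
  apply: measurableT_comp => //; apply: measurable_funB => //.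
  by apply: measurableT_comp => //; exact: measurable_clamp.
have [] := @dominated_convergence _ _ _ P _ measurableT (fun n t => (r n t)%:E)
  (cst 0%E) (fun t => `|F t|%:E).
- by move=> n; exact/measurable_EFinP.
- exact: measurable_cst.
- apply: aeW => t _; apply: cvg_near_cst; near=> n.
  rewrite /r clamp_id ?subrr ?normr0//.
  by near: n; exact: nbhs_infty_ger.
- exact/Lfun1_integrable/integrable_norm.
- apply: aeW => t n _ /=; rewrite lee_fin /r normr_id.
  exact: norm_sub_clamp_le.
move=> _ _; rewrite integral_cst// mul0e => rcvg.
have ir n : r n \in Lfun P 1.
  apply: (le_integrable_Lfun _ iF) => // t; rewrite /r normr_id.
  exact: norm_sub_clamp_le.
have /fine_cvgP[_ /cvgrPdist_le/(_ _ e0)[N _ /(_ N (leqnn _))]] := rcvg.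
rewrite /= sub0r normrN => rN; exists N%:R => //.
by apply: le_trans rN; rewrite /mean unlock; exact: ler_norm.
Unshelve. all: by end_near. Qed.

Section WeakLaw.
Context {d'} {T' : measurableType d'} (X : nat -> {RV P >-> T'}).
Hypothesis X_iid : iid X.

Lemma iid_pair_independent (f g : T' -> R) i k : i != k ->
  measurable_fun setT f -> measurable_fun setT g ->
  forall A B, measurable A -> measurable B ->
  P ((f \o X i) @^-1` A `&` (g \o X k) @^-1` B) =
  (P ((f \o X i) @^-1` A) * P ((g \o X k) @^-1` B))%E.
Proof.
move=> ik mf mg A B mA mB.
have mfA : measurable (f @^-1` A).
  by rewrite -[X in measurable X]setTI; exact: mf.
have mgB : measurable (g @^-1` B).
  by rewrite -[X in measurable X]setTI; exact: mg.
pose C j := if j == i then f @^-1` A else g @^-1` B.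
have := X_iid.1 [:: i; k] C.
rewrite !big_cons !big_nil/= setIT mule1 inE ik /C eqxx eq_sym (negbTE ik).
by apply=> // j; case: ifP.
Qed.

Lemma iid_integrable (f : T' -> R) i : measurable_fun setT f ->
  f \o X 0%N \in Lfun P 1 -> f \o X i \in Lfun P 1.
Proof.
move=> mf /Lfun1_integrable/integrableP[_ if0]; apply/Lfun1_integrable.
have mf' : measurable_fun setT (fun y => `|f y|%:E).
  by apply/measurable_EFinP; exact: measurableT_comp.
apply/integrableP; split.
  by apply/measurable_EFinP; exact: measurableT_comp.
move: if0; rewrite -[X in (X < _)%E -> _](ge0_integral_distribution _ mf')//.
rewrite -[X in _ -> (X < _)%E](ge0_integral_distribution _ mf')//.
rewrite [X in _ -> (X < _)%E](eq_measure_integral (distribution P (X 0%N)))//.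
by move=> A mA _; exact: X_iid.2.
Qed.

Lemma iid_mean (f : T' -> R) i : measurable_fun setT f ->
  f \o X 0%N \in Lfun P 1 -> mean (f \o X i) = mean (f \o X 0%N).
Proof.
move=> mf if0; have ifi := iid_integrable f i mf if0.
have mf' : measurable_fun setT (EFin \o f) by exact/measurable_EFinP.
rewrite /mean unlock.
rewrite -(@integral_distribution _ _ _ _ _ P (X i) (EFin \o f))//; last first.
  exact/Lfun1_integrable.
rewrite -(@integral_distribution _ _ _ _ _ P (X 0%N) (EFin \o f))//; last first.
  exact/Lfun1_integrable.
congr fine; apply: eq_measure_integral => A mA _; exact: X_iid.2.
Qed.

(** Khinchin's weak law. Truncation at a fixed level M splits the average into
    a bounded part, whose variance is of order 1/n, and a tail whose mean is
    small uniformly in n. *)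
Lemma weak_law (f : T' -> R) : measurable_fun setT f ->
  f \o X 0%N \in Lfun P 1 ->
  vanishes_in_mean
    (fun n t => average (fun i => f \o X i) n t - mean (f \o X 0%N)).
Proof.
move=> mf if0; have ifi i := iid_integrable f i mf if0.
set mu := mean _.
apply: vanishes_in_meanP => [n|e e0].
  by apply: integrableB; [exact: integrable_average|exact: integrable_cst].
have e30 : 0 < e / 3 by lra.
have [M M0 Me] := clamp_tail (e / 3) if0 e30.
pose g := clamp M \o f.
have mg : measurable_fun setT g.
  by apply: measurableT_comp => //; exact: measurable_clamp.
pose h y := f y - g y.
have mh : measurable_fun setT h by exact: measurable_funB.
have ih0 : h \o X 0%N \in Lfun P 1.
  apply: (le_integrable_Lfun _ if0); first exact: measurableT_comp.
  by move=> t; exact: norm_sub_clamp_le.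
have ihi i := iid_integrable h i mh ih0.
have ibounded (F : T -> R) (K : R) : measurable_fun setT F ->
    (forall t, `|F t| <= K) -> F \in Lfun P 1.
  move=> mF FK; apply: (le_integrable_Lfun mF (integrable_cst K)) => t.
  exact: le_trans (FK t) (ler_norm _).
have igi i : g \o X i \in Lfun P 1.
  apply: (ibounded _ M); first exact: measurableT_comp.
  by move=> t; exact: norm_clamp_le.
pose a := mean (g \o X 0%N).
pose k y := g y - a.
have mk : measurable_fun setT k by exact: measurable_funB.
have iki i : k \o X i \in Lfun P 1.
  exact: (integrableB (igi i) (integrable_cst a)).
have k0 i : mean (k \o X i) = 0.
  rewrite (_ : k \o X i = (fun t => (g \o X i) t - a))// meanB//.
    by rewrite iid_mean// mean_cst subrr.
  exact: integrable_cst.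
have kM y : `|k y| <= M + `|a|.
  by rewrite (le_trans (ler_normB _ _))// lerD2r norm_clamp_le.
have kkM i j t : `|(k \o X i) t * (k \o X j) t| <= (M + `|a|) * (M + `|a|).
  by rewrite normrM ler_pM// kM.
have ikk i j : (fun t => (k \o X i) t * (k \o X j) t) \in Lfun P 1.
  apply: (ibounded _ ((M + `|a|) * (M + `|a|))); last exact: kkM.
  by apply: measurable_funM; exact: measurableT_comp.
have van : vanishes_in_mean (average (fun i => k \o X i)).
  apply: (@average_orthogonal _ ((M + `|a|) * (M + `|a|))) => //.
    move=> i j ij.
    have [_ ->] := mean_mul_independent (iki i) (iki j)
      (iid_pair_independent k k i j ij mk mk).
    by rewrite k0 mul0r.
  move=> i; rewrite -[leRHS]mean_cst; apply: le_mean => //.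
    exact: integrable_cst.
  by move=> t; rewrite (le_trans (ler_norm _))// kkM.
have amu : `|a - mu| <= e / 3.
  rewrite distrC -meanB//; apply: le_trans (norm_mean_le _) Me.
  exact: (integrableB if0 (igi 0%N)).
near=> n.
have n0 : (0 < n)%N by near: n; exists 1%N.
have n0' : (0 : R) < n%:R by rewrite ltr0n.
have le1 t : `|average (fun i => f \o X i) n t - mu| <=
    `|average (fun i => k \o X i) n t| +
    (n%:R^-1 * \sum_(i < n) `|h (X i t)| + e / 3).
  have -> : average (fun i => f \o X i) n t - mu =
      average (fun i => k \o X i) n t + (average (fun i => h \o X i) n t
        + (a - mu)).
    rewrite addrA addrA; congr (_ - _).
    have -> : a = n%:R^-1 * \sum_(i < n) a.
      by rewrite sumr_const card_ord -[a *+ n]mulr_natl mulKf// gt_eqF.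
    rewrite -!mulrDr -!big_split/=; congr (_ * _); apply: eq_bigr => i _.
    by rewrite /k /h /=; ring.
  rewrite (le_trans (ler_normD _ _))// lerD2l (le_trans (ler_normD _ _))//.
  rewrite lerD// normrM ger0_norm ?invr_ge0// ler_wpM2l ?invr_ge0//.
  exact: ler_norm_sum.
have ihn i : (fun t => `|h (X i t)|) \in Lfun P 1 := integrable_norm (ihi i).
have iav : (fun t => n%:R^-1 * \sum_(i < n) `|h (X i t)|) \in Lfun P 1.
  by apply: integrableZ; exact: integrable_sum.
have ik : (fun t => `|average (fun i => k \o X i) n t|) \in Lfun P 1.
  by apply/integrable_norm/integrable_average.
have ie : (fun t => n%:R^-1 * \sum_(i < n) `|h (X i t)| + e / 3) \in Lfun P 1.
  by apply: integrableD => //; exact: integrable_cst.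
apply: (le_trans (le_mean _ _ le1)).
- apply: integrable_norm; apply: integrableB; last exact: integrable_cst.
  exact: integrable_average.
- exact: integrableD.
rewrite !meanD ?mean_cst ?meanZ ?mean_sum//; last 2 first.
  exact: integrable_sum.
  exact: integrable_cst.
have -> : \sum_(i < n) mean (fun t => `|h (X i t)|) =
    n%:R * mean (fun t => `|h (X 0%N t)|).
  rewrite (eq_bigr (fun=> mean (fun t => `|h (X 0%N t)|))) => [|i _].
    by rewrite sumr_const card_ord mulr_natl.
  apply: (iid_mean (fun y => `|h y|) i); last exact: ihn.
  exact: measurableT_comp.
rewrite mulKf ?gt_eqF//.
have : mean (fun t => `|average (fun i => k \o X i) n t|) <= e / 3.
  by near: n; exact: vanishes_in_mean_le.
move: Me; rewrite /h /g /=; lra.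
Unshelve. all: by end_near. Qed.

End WeakLaw.

(** * Empirical covariance and score *)

(** The two factors are measurable for the sigma-algebra generated by the whole
    sequence, hence so is their product. *)
Lemma sigma_of_mul {d'} {T' : measurableType d'} (Z : nat -> {RV P >-> T'})
    (f : T' -> R) i k : measurable_fun setT f ->
  forall A, measurable A ->
    sigma_of Z ((fun t => f (Z i t) * f (Z k t)) @^-1` A).
Proof.
move=> mf A mA.
pose S := g_sigma_algebraType
  (\bigcup_j preimage_set_system setT (Z j) measurable).
have mfZ j : measurable_fun setT (fun t : S => f (Z j t)).
  move=> _ B mB; apply: sub_sigma_algebra; exists j => //.
  exists (f @^-1` B) => //.
  by rewrite -[X in measurable X]setTI; exact: mf.
have := @measurable_funM _ S R setT _ _ (mfZ i) (mfZ k).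
by move=> /(_ measurableT A mA); rewrite setTI.
Qed.

Lemma Lfun2_Lfun1 {F} : F \in Lfun P 2%:E -> F \in Lfun P 1.
Proof. by apply: Lfun_subset12; exact: fin_num_measure. Qed.

Section LinearModel.
Context {p : nat} (X : nat -> {RV P >-> p.-tuple R})
  (eps : nat -> {RV P >-> R}) (C : 'M[R]_p) (sigma : R).
Hypotheses (X_iid : iid X) (X_cov : forall i, centered_with_covariance (X i) C)
  (eps_iid : iid eps)
  (eps_var : forall i, centered_with_variance (eps i) (sigma ^+ 2))
  (X_eps : independent_sequences X eps).

Lemma gram_law j k : vanishes_in_mean (fun n t =>
  (n%:R^-1 *: ((design X n t)^T *m design X n t)) j k - C j k).
Proof.
pose f (u : p.-tuple R) := tnth u j * tnth u k.
have mf : measurable_fun setT f.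
  by apply: measurable_funM; exact: measurable_tnth.
have [X2 X0 XC] := X_cov 0%N.
have if0 : f \o X 0%N \in Lfun P 1 := Lfun2_mul_Lfun1 (X2 j) (X2 k).
have Cjk : C j k = mean (f \o X 0%N).
  have := XC j k; rewrite covarianceE; last 3 first.
  - exact: Lfun2_Lfun1.
  - exact: Lfun2_Lfun1.
  - exact: if0.
  by rewrite !X0 mule0 sube0 => /(congr1 fine) /= <-.
have := weak_law X X_iid f mf if0.
congr vanishes_in_mean; apply/funext => n; apply/funext => t.
rewrite !mxE -Cjk /average; congr (_ * _ - _).
by apply: eq_bigr => i _; rewrite !mxE.
Qed.

(** The products X_ij X_kj and eps_i eps_k are independent, so the summands
    X_ij eps_i satisfy E[Y_i Y_k] = E[X_ij X_kj] E[eps_i eps_k]: this vanishes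
    for i <> k and equals C_jj sigma^2 for i = k. *)
Lemma score_law j : vanishes_in_mean (fun n t =>
  (n%:R^-1 *: ((design X n t)^T *m noise eps n t)) j 0).
Proof.
pose f (u : p.-tuple R) := tnth u j.
have mf : measurable_fun setT f by exact: measurable_tnth.
have mid : measurable_fun setT (@id R) by [].
have f2 i : (fun t => f (X i t)) \in Lfun P 2%:E.
  by have [+ _ _] := X_cov i; exact.
have e2 i : (eps i : T -> R) \in Lfun P 2%:E by have [] := eps_var i.
have iff i k : (fun t => f (X i t) * f (X k t)) \in Lfun P 1.
  exact: (Lfun2_mul_Lfun1 (f2 i) (f2 k)).
have iee i k : (fun t => eps i t * eps k t) \in Lfun P 1.
  exact: (Lfun2_mul_Lfun1 (e2 i) (e2 k)).
have e0 i : mean (eps i) = 0 by rewrite /mean; have [_ ->] := eps_var i.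
have ee0 i k : i != k -> mean (fun t => eps i t * eps k t) = 0.
  move=> ik; have [_ ->] := mean_mul_independent (Lfun2_Lfun1 (e2 i))
    (Lfun2_Lfun1 (e2 k))
    (iid_pair_independent eps eps_iid id id i k ik mid mid).
  by rewrite e0 mul0r.
have eeE i : mean (fun t => eps i t * eps i t) = sigma ^+ 2.
  have [_ E0 V] := eps_var i; move: V.
  rewrite varianceE// E0 expe2 mule0 sube0 => /(congr1 fine)/= <-.
  by rewrite /mean; congr (fine 'E_P[_]).
have ffE i : mean (fun t => f (X i t) * f (X i t)) = C j j.
  have [X2 X0 XC] := X_cov i; have := XC j j; rewrite covarianceE.
  - by rewrite !X0 mule0 sube0 => /(congr1 fine) /= <-.
  - exact: Lfun2_Lfun1.
  - exact: Lfun2_Lfun1.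
  - exact: iff.
pose Y i t := f (X i t) * eps i t.
have iY i : Y i \in Lfun P 1.
  exact: (Lfun2_mul_Lfun1 (f2 i) (e2 i)).
have YYE i k : (fun t => Y i t * Y k t) =
    (fun t => (f (X i t) * f (X k t)) * (eps i t * eps k t)).
  by apply/funext => t; rewrite /Y mulrACA.
have YY i k : (fun t => Y i t * Y k t) \in Lfun P 1 /\
    mean (fun t => Y i t * Y k t) =
    mean (fun t => f (X i t) * f (X k t)) * mean (fun t => eps i t * eps k t).
  rewrite YYE; apply: mean_mul_independent => // A B mA mB.
  apply: X_eps; first exact: sigma_of_mul.
  exact: (sigma_of_mul eps id).
have : vanishes_in_mean (average Y).
  apply: (average_orthogonal Y (C j j * sigma ^+ 2)) => // [i k|i k ik|i].
  - exact: (YY i k).1.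
  - by rewrite (YY i k).2 ee0// mulr0.
  - by rewrite (YY i i).2 ffE eeE.
congr vanishes_in_mean; apply/funext => n; apply/funext => t.
rewrite !mxE /average; congr (_ * _).
by apply: eq_bigr => i _; rewrite !mxE.
Qed.

End LinearModel.

End Expectation.

(** * Convergence in probability *)

Section ConvergenceInProbability.
Context {d : measure_display} {T : measurableType d} {R : realType}
  (P : probability T R) {p : nat}.

Lemma measurable_l2norm_gt (Y : {RV P >-> p.-tuple R}) (b : 'cV[R]_p)
    (eta : R) :
  0 < eta -> measurable [set t | eta < l2norm (vec (Y t) - b)].
Proof.
move=> eta0.
have mS : measurable_fun setT
    (fun t => \sum_(i < p) (tnth (Y t) i - b i 0) ^+ 2).
  have mi (i : 'I_p) :
      measurable_fun setT (fun t => (tnth (Y t) i - b i 0) ^+ 2).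
    have mYi : measurable_fun setT (fun t => tnth (Y t) i).
      by apply: (measurableT_comp (measurable_tnth _)).
    apply: (@measurable_funX _ _ _ _ (fun t => tnth (Y t) i - b i 0) 2).
    exact: measurable_funB.
  exact: measurable_sum.
have mA : measurable_fun setT
    (fun t => eta ^+ 2 < \sum_(i < p) (tnth (Y t) i - b i 0) ^+ 2).
  exact: measurable_fun_ltr.
have lE t : (eta < l2norm (vec (Y t) - b)) =
    (eta ^+ 2 < \sum_(i < p) (tnth (Y t) i - b i 0) ^+ 2).
  rewrite -(@ltr_pXn2r _ 2)// ?nnegrE ?sqrtr_ge0 ?(ltW eta0)// sqr_l2norm.
  by congr (_ < _); apply: eq_bigr => i _; rewrite !mxE.
under eq_set do rewrite lE.
by have := mA measurableT [set true] I; rewrite setTI.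
Qed.

(** Markov's inequality applied to the controlling variable S: a deviation of Y
    larger than eta forces |S| > delta. *)
Lemma cvg_in_probability_of_mean (Y : nat -> {RV P >-> p.-tuple R})
    (b : 'cV[R]_p) (S : nat -> T -> R) :
  vanishes_in_mean P S ->
  (forall eta, 0 < eta -> exists2 delta : R, 0 < delta &
     \forall n \near \oo, forall t, `|S n t| <= delta ->
       l2norm (vec (Y n t) - b) <= eta) ->
  cvg_in_probability Y b.
Proof.
move=> [iS S0] SY eta eta0; have [delta d0 near_le] := SY _ eta0.
have mbound :
    (fun n => (delta^-1 * mean P (fun t => `|S n t|))%:E) @ \oo --> 0%E.
  apply: cvg_EFin; first exact: nearW.
  by rewrite -[X in _ --> X](mulr0 delta^-1); apply: cvgM => //; exact: cvg_cst.
apply: (squeeze_cvge _ (cvg_cst 0%E) mbound).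
apply: filterS near_le => n Sn; apply/andP; split; first exact: measure_ge0.
have mS := integrable_measurable P (iS n).
pose Sn' : {mfun T >-> R} := HB.pack (S n) (isMeasurableFun.Build _ _ _ _ _ mS).
have := @markov _ _ _ P Sn' id delta d0 (@measurable_id _ _ _) (fun _ => id)
  (fun x y _ _ => id).
rewrite /= -(mean_fineK P (integrable_norm P (iS n))) => mk.
rewrite EFinM lee_pdivlMl//; apply: le_trans mk.
rewrite lee_pmul2l// ?lte_fin// le_measure ?inE//.
- by apply/mem_set; exact: measurable_l2norm_gt.
- apply/mem_set.
  have mN : measurable_fun setT (fun t => (delta <= `|S n t|)).
    by apply: measurable_fun_ler => //; exact: measurableT_comp.
  by have := mN measurableT [set true] I; rewrite setTI.
- move=> t /= et; rewrite lee_fin leNgt; apply/negP => /ltW /Sn.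
  by rewrite leNgt et.
Qed.

End ConvergenceInProbability.

Theorem theorem2p1 (d : measure_display) (T : measurableType d) (R : realType)
    (P : probability T R) (p : nat)
    (X : nat -> {RV P >-> p.-tuple R}) (eps : nat -> {RV P >-> R})
    (beta0 : 'cV[R]_p) (C : 'M[R]_p) (sigma : R)
    (lam : nat -> 'cV[R]_p) (lambda : 'cV[R]_p)
    (betahat : nat -> {RV P >-> p.-tuple R})
    (X_iid : iid X)
    (X_cov : forall i, centered_with_covariance (X i) C)
    (eps_iid : iid eps)
    (eps_var : forall i, centered_with_variance (eps i) (sigma ^+ 2))
    (X_eps : independent_sequences X eps)
    (lam_weights : forall n, slope_weights (lam n))
    (lambda_weights : slope_weights lambda)
    (lam_cvg : (fun n : nat => n%:R^-1 *: lam n) @ \oo --> lambda)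
    (C_posdef : posdef C)
    (betahat_slope : forall n,
       slope_estimator X eps beta0 (lam n) n (betahat n)) :
  (exists betastar : 'cV[R]_p,
     argmin (slope_limit C beta0 lambda) = [set betastar] /\
     cvg_in_probability betahat betastar) /\
  (lambda = 0 -> cvg_in_probability betahat beta0).
Proof.
(* All sampling errors as one finite family: the entries of n^-1 X^T X - C,
   followed by those of n^-1 X^T eps. *)
pose err (i : 'I_p * 'I_p + 'I_p) n t : R := match i with
  | inl jk => (n%:R^-1 *: ((design X n t)^T *m design X n t)) jk.1 jk.2
              - C jk.1 jk.2
  | inr j => (n%:R^-1 *: ((design X n t)^T *m noise eps n t)) j 0
  end.
have err0 : vanishes_in_mean P
    (fun n t => \sum_(i : 'I_p * 'I_p + 'I_p) `|err i n t|).
  apply: vanishes_in_mean_sum_norm => -[[j k]|j].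
  - exact: (gram_law P X C X_iid X_cov j k).
  - exact: (score_law P X eps C sigma X_cov eps_iid eps_var X_eps j).
have lam1 : (fun n => norm1 (n%:R^-1 *: lam n - lambda)) @ \oo --> (0 : R).
  have l0 j : (fun n => `|(n%:R^-1 *: lam n - lambda) j 0|) @ \oo --> (0 : R).
    have lj : (fun n => (n%:R^-1 *: lam n) j 0) @ \oo --> lambda j 0.
      exact: (cvg_comp _ _ lam_cvg (@coord_continuous R _ _ j 0 lambda)).
    rewrite (_ : (fun n => _) =
        (fun n => `|(n%:R^-1 *: lam n) j 0 - lambda j 0|)); last first.
      by apply/funext => n; rewrite !mxE.
    have -> : (0 : R) = `|lambda j 0 - lambda j 0| by rewrite subrr normr0.
    by apply: cvg_norm; apply: cvgB => //; exact: cvg_cst.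
  by have := cvg_sumr (index_enum _) _ _ l0; rewrite big1.
have consistent a : argmin (slope_limit C beta0 lambda) a ->
    cvg_in_probability betahat a.
  move=> amin; apply: (cvg_in_probability_of_mean P _ _ _ err0) => eta eta0.
  have [delta d0 stable] := slope_stability C beta0 lambda C_posdef
    lambda_weights a eta amin eta0.
  exists delta => //.
  move/cvgrPdist_le : lam1 => /(_ _ d0); apply: filterS => n.
  rewrite sub0r normrN ger0_norm ?norm1_ge0// => ln t.
  rewrite ger0_norm ?sumr_ge0// big_sumType/= => errn.
  have s1 : 0 <= \sum_(jk : 'I_p * 'I_p) `|err (inl jk) n t| by exact: sumr_ge0.
  have s2 : 0 <= \sum_(j : 'I_p) `|err (inr j) n t| by exact: sumr_ge0.
  apply: stable ln (betahat_slope n t).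
  - by rewrite pair_bigA /=; apply: le_trans errn; rewrite lerDl.
  - by apply: le_trans errn; rewrite lerDr.
have [a amin] :=
  slope_limit_argmin_exists C beta0 lambda C_posdef lambda_weights.
split.
  exists a; split; last exact: consistent.
  apply/seteqP; split=> [b bmin|_ ->//].
  exact: (slope_limit_argmin_unique C beta0 lambda C_posdef lambda_weights).
move=> lambda0; apply: consistent => b; rewrite lambda0.
have J0 v : slope_norm 0 v = 0 :> R.
  by rewrite /slope_norm big1// => i _; rewrite mxE mul0r.
rewrite /slope_limit !J0 !addr0 subrr mulmx0 mxE mulr0.
by rewrite mulr_ge0// ?invr_ge0//; exact: posdef_bil_ge0.
Qed.
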